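(* Suppose $p^{\min}=\min_{\alpha\in\mathcal A\setminus\{0\}}p(\alpha)$ and $p^{\max}=\max_{\alpha\in\mathcal A\setminus\{0\}}p(\alpha)$ are finite and strictly positive. Then the proposed single-user algorithm with parameter $V>0$ (described in the context) achieves the constraint $$\limsup_{T\to\infty}\frac1T\sum_{t=0}^{T-1}p(\alpha(t))\le\beta$$ and yields throughput satisfying, with probability 1, $$\liminf_{T\to\infty}\frac1T\sum_{t=0}^{T-1}\overline B\,\phi(\alpha(t))\ge\mu^*-\frac{C_0}{V},$$ where $C_0$ is a constant independent of $V$ and $\mu^*$ is the optimal throughput of the problem in the context.
   Context: **Model.** Slotted time; file state $F(t)\in\{0,1\}$ of a single user. An action set $\mathcal A$ contains an idle action $0$; there are functions $\phi:\mathcal A\to[0,1]$ with $\phi(0)=0$ (file completion probability) and $p:\mathcal A\to[0,\infty)$ with $p(0)=0$ (power). The user sets $\alpha(t)=0$ when $F(t)=0$ and chooses $\alpha(t)\in\mathcal A$ when $F(t)=1$. Transitions: $\Pr[F(t+1)=0|F(t)=1]=\phi(\alpha(t))$, $\Pr[F(t+1)=1|F(t)=1]=1-\phi(\alpha(t))$, $\Pr[F(t+1)=1|F(t)=0]=\lambda$, $\Pr[F(t+1)=0|F(t)=0]=1-\lambda$, with $\lambda>0$, and given the current state and action the transition is independent of the past. $\overline B>0$ is the mean file size and $\beta>0$ a power budget. **Problem.** Maximize $\liminf_{T\to\infty}\frac1T\sum_{t=0}^{T-1}\overline B\phi(\alpha(t))$ subject to $\limsup_{T\to\infty}\frac1T\sum_{t=0}^{T-1}p(\alpha(t))\le\beta$,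 over decision policies that set $\alpha(t)=0$ on every slot with $F(t)=0$ and choose $\alpha(t)\in\mathcal A$ on every slot with $F(t)=1$. $\mu^*$ is the optimal throughput; it is attained by an i.i.d. randomized policy, i.e. there is a random choice $\alpha^*$ of action, made independently with the same distribution on $\mathcal A$ on every slot with $F(t)=1$, such that $\frac{\overline B\,\mathbb E[\phi(\alpha^* )]}{1+\mathbb E[\phi(\alpha^* )]/\lambda}=\mu^*$ and $\frac{\mathbb E[p(\alpha^* )]}{1+\mathbb E[\phi(\alpha^* )]/\lambda}\le\beta$. **Algorithm.** Let $t_k$ be the $k$-th time the state is $1$ (time counted so that each slot with $F(t)=1$ starts a renewal frame), $T[k]=t_{k+1}-t_k$. A virtual queue has $Q[0]=0$ and $Q[k+1]=\max\{Q[k]+p(\alpha(t_k))-\beta T[k],0\}$. At each $t_k$ the user observes $Q[k]$ and chooses $\alpha(t_k)\in\mathcal A$ maximizing $$\frac{V\overline B\phi(\alpha(t_k))-Q[k]p(\alpha(t_k))}{1+\phi(\alpha(t_k))/\lambda}$$ (ties broken arbitrarily; the maximum is assumed attained). *)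

(* Defs.v *)
From HB Require Import structures.
From mathcomp Require Import all_boot all_order all_algebra.
From mathcomp Require Import all_classical all_reals all_analysis.

Set Implicit Arguments.
Unset Strict Implicit.
Unset Printing Implicit Defensive.

Import Order.TTheory GRing.Theory Num.Theory.
Import numFieldNormedType.Exports.

Local Open Scope classical_set_scope.
Local Open Scope ring_scope.

Definition is_min (R : realType) (S : set R) (m : R) : Prop :=
  S m /\ lbound S m.

Definition is_max (R : realType) (S : set R) (m : R) : Prop :=
  S m /\ ubound S m.

(* [u] is summed over the slots 0, ..., T - 1; the (irrelevant) value at T = 0
   is 0. The limits are taken in the extended reals, where they always exist. *)
Definition time_average (R : realType) (u : nat -> R) (T : nat) : R :=
  T%:R^-1 * \sum_(0 <= t < T) u t.

Definition limsup_average (R : realType) (u : nat -> R) : \bar R :=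
  limn_esup (fun T => (time_average u T)%:E).

Definition liminf_average (R : realType) (u : nat -> R) : \bar R :=
  limn_einf (fun T => (time_average u T)%:E).

(* Pr[F(t+1) = g | F(t) = f, alpha(t) = a]; the file state 1 is [true]. *)
Definition transition (R : realType) (A : Type) (phi : A -> R) (lambda : R)
    (f : bool) (a : A) (g : bool) : R :=
  match f, g with
  | true, false => phi a
  | true, true => 1 - phi a
  | false, true => lambda
  | false, false => 1 - lambda
  end.

(* The sigma-algebra generated by F(0), alpha(0), ..., F(t), alpha(t). *)
Definition history (d d' : measure_display) (Omega : measurableType d)
    (A : measurableType d') (F : nat -> Omega -> bool)
    (alpha : nat -> Omega -> A) (t : nat) : set (set Omega) :=
  <<s [set E | exists2 s : nat, (s <= t)%N &
         E = F s @^-1` [set true] \/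
         exists2 B : set A, measurable B & E = alpha s @^-1` B] >>.

(* A file-state process driven by a decision policy. The policy may be
   randomized and use the whole past; [policy_transition] is the defining
   property of the conditional probability of F(t+1) = g given the past,
   the current state and the current action. The law of F(0) is arbitrary. *)
Record decision_policy (R : realType) (d d' : measure_display)
    (A : measurableType d') (idle : A) (phi : A -> R) (lambda : R)
    (Omega : measurableType d) (P : probability Omega R)
    (F : nat -> Omega -> bool) (alpha : nat -> Omega -> A) : Prop := {
  policy_state_measurable : forall t, measurable_fun setT (F t);
  policy_action_measurable : forall t, measurable_fun setT (alpha t);
  policy_idle : forall t w, F t w = false -> alpha t w = idle;
  policy_transition : forall (t : nat) (E : set Omega) (g : bool),
    history F alpha t E ->
    P (E `&` F t.+1 @^-1` [set g]) =
      (\int[P]_(w in E) (transition phi lambda (F t w) (alpha t w) g)%:E)%E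
}.

(* mu is guaranteed, with probability 1, by some policy (on some probability
   space) that meets the power constraint with probability 1. *)
Definition achievable_throughput (R : realType) (d' : measure_display)
    (A : measurableType d') (idle : A) (phi p : A -> R)
    (lambda B beta : R) (mu : R) : Prop :=
  exists (d : measure_display) (Omega : measurableType d)
    (P : probability Omega R) (F : nat -> Omega -> bool)
    (alpha : nat -> Omega -> A),
    [/\ decision_policy idle phi lambda P F alpha,
        {ae P, forall w,
          (limsup_average (fun t => p (alpha t w)) <= beta%:E)%E} &
        {ae P, forall w,
          (mu%:E <= liminf_average (fun t => B * phi (alpha t w))%R)%E}].

(* For nonnegative data this is a supremum of a nonempty set (always idling
   achieves 0) that is bounded above by B. *)
Definition optimal_throughput (R : realType) (d' : measure_display)
    (A : measurableType d') (idle : A) (phi p : A -> R)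
    (lambda B beta : R) : R :=
  sup [set mu | achievable_throughput idle phi p lambda B beta mu].

(* [nu] is the law of the random choice of action made, independently, on each
   slot with F(t) = 1; 1 + E[phi] / lambda is the mean length of the resulting
   renewal frames. *)
Definition attained_by_iid (R : realType) (d' : measure_display)
    (A : measurableType d') (phi p : A -> R) (lambda B beta mu : R) : Prop :=
  exists nu : probability A R,
    B * fine 'E_nu[phi] / (1 + fine 'E_nu[phi] / lambda) = mu /\
    fine 'E_nu[p] / (1 + fine 'E_nu[phi] / lambda) <= beta.

(* t is the time of the k-th visit (counted from k = 0) of the path f to 1. *)
Definition is_frame_start (f : nat -> bool) (k t : nat) : Prop :=
  f t /\ (\sum_(0 <= s < t) f s)%N = k.

(* Defaults to 0 if f visits 1 at most k times. *)
Definition frame_start (f : nat -> bool) (k : nat) : nat :=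
  xget 0%N [set t | is_frame_start f k t].

Definition frame_length (f : nat -> bool) (k : nat) : nat :=
  (frame_start f k.+1 - frame_start f k)%N.

(* Q[k] involves t_0, ..., t_k only, hence no default value of [frame_start]
   whenever the k-th frame does start. *)
Fixpoint virtual_queue (R : realType) (A : Type) (p : A -> R) (beta : R)
    (f : nat -> bool) (a : nat -> A) (k : nat) : R :=
  if k is k'.+1 then
    Num.max (virtual_queue p beta f a k' + p (a (frame_start f k'))
             - beta * (frame_length f k')%:R) 0
  else 0.

Definition frame_ratio (R : realType) (A : Type) (phi p : A -> R)
    (lambda B V q : R) (a : A) : R :=
  (V * B * phi a - q * p a) / (1 + phi a / lambda).

Definition follows_algorithm (R : realType) (A : Type) (phi p : A -> R)
    (lambda B beta V : R) (f : nat -> bool) (a : nat -> A) : Prop :=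
  forall k t, is_frame_start f k t ->
    forall b : A,
      frame_ratio phi p lambda B V (virtual_queue p beta f a k) b <=
      frame_ratio phi p lambda B V (virtual_queue p beta f a k) (a t).

(* Main.v *)
Require Import Defs.
From HB Require Import structures.
From mathcomp Require Import all_boot all_order all_algebra.
From mathcomp Require Import all_classical all_reals all_analysis.
From mathcomp Require Import measurable_realfun.
From mathcomp Require Import ring lra zify.

Set Implicit Arguments.
Unset Strict Implicit.
Unset Printing Implicit Defensive.

Import Order.TTheory GRing.Theory Num.Theory.
Import numFieldNormedType.Exports.

Local Open Scope classical_set_scope.
Local Open Scope ring_scope.

(* Drift-plus-penalty, carried out slot by slot. Since power is only spent in
   the first slot of a frame, Q[k] is the value at t_k of the queue
   Z(t+1) = max(Z(t) + p(alpha(t)) - beta, 0). When Z exceeds V B / pmin every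
   non-idle action has a negative ratio, so Z is bounded on every path; this
   gives the power constraint. Averaging the maximality of the ratio over the
   i.i.d. policy shows that the maximum is at least W = V mu - beta Z. With
   N = 1{F = 0} and the innovation D(t) = N(t+1) - E[N(t+1) | past], the
   function Psi = Z^2 / 2 + W N / lambda satisfies, on every path,
   V B phi >= V mu - C0 + Psi(t+1) - Psi(t) - W D / lambda.
   The sum of the bounded martingale increments W D is o(T) almost surely: its
   second moment grows linearly, hence is summable after normalization along
   the squares, and between squares the increments are bounded. *)

(** * The power queue run slot by slot, and its agreement with the frame queue *)

Section Paths.
Variables (R : realType) (A : Type) (p : A -> R) (beta : R).
Implicit Types (f : nat -> bool) (a : nat -> A).

Fixpoint slot_queue a (t : nat) : R :=
  if t is t'.+1 then Num.max (slot_queue a t' + p (a t') - beta) 0 else 0.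

Lemma slot_queue_ge0 a t : 0 <= slot_queue a t.
Proof. by case: t => [|t] //=; rewrite le_max lexx orbT. Qed.

Lemma slot_queue_step a t :
  slot_queue a t + p (a t) - beta <= slot_queue a t.+1.
Proof. by rewrite /= le_max lexx. Qed.

(** Telescopes [slot_queue_step]; once the queue is bounded, this becomes the power constraint. *)
Lemma sum_power_le a T :
  \sum_(0 <= t < T) p (a t) <= slot_queue a T + beta * T%:R.
Proof.
elim: T => [|T IH]; first by rewrite big_geq//= mulr0 addr0.
rewrite big_nat_recr//= -natr1.
have := slot_queue_step a T => /=; lra.
Qed.

(** If [s < t], the visit at [s] is itself counted before [t], so the count at [t] would exceed
    [k]. *)
Lemma is_frame_start_leq f k s t :
  is_frame_start f k s -> is_frame_start f k t -> (t <= s)%N.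
Proof.
move=> [fs cs] [_ ct]; rewrite leqNgt; apply/negP => st.
have : (\sum_(0 <= i < s.+1) f i <= \sum_(0 <= i < t) f i)%N.
  by rewrite [leqRHS](@big_cat_nat _ _ _ s.+1)//= leq_addr.
by rewrite big_nat_recr//= cs ct fs addn1 ltnn.
Qed.

Lemma frame_startE f k t : is_frame_start f k t -> frame_start f k = t.
Proof.
move=> ft; have fx := xgetI 0%N ft.
by apply/eqP; rewrite eqn_leq !(@is_frame_start_leq f k).
Qed.

(* Truncating at 0 once per frame or once per slot is the same, because power
   is only spent in the first slot of a frame. *)
Lemma slot_queue_frame f a k t :
    (forall s, ~~ f s -> p (a s) = 0) -> 0 <= beta ->
  is_frame_start f k t -> virtual_queue p beta f a k = slot_queue a t.
Proof.
move=> pa0 beta0.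
have atstart s : f s -> is_frame_start f (\sum_(0 <= i < s) f i)%N s by [].
(* Either no frame has started and the queue is empty, or [j] is the latest frame, [r] its start,
   and the queue is the update of [Q[j]] with only the [s - r] slots elapsed so far charged.
   Truncating before a further subtraction of [beta] is harmless because [beta] is nonnegative. *)
have inv s : ((\sum_(0 <= i < s) f i)%N = 0%N /\ slot_queue a s = 0) \/
    exists j r, [/\ (\sum_(0 <= i < s) f i)%N = j.+1, is_frame_start f j r,
      (r < s)%N & slot_queue a s =
        Num.max (virtual_queue p beta f a j + p (a r) - beta * (s - r)%:R) 0].
  elim: s => [|s IH]; first by left; rewrite big_geq.
  have [fs|nfs] := boolP (f s); last first.
    rewrite big_nat_recr//= pa0// (negbTE nfs) addn0 addr0.
    case: IH => [[-> ->]|[j [r [-> jr rs ->]]]].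
      by left; split=> //; apply: max_r; lra.
    right; exists j, r; split => //; first exact: ltnW.
    rewrite subSn; last exact: ltnW.
    rewrite -natr1 mulrDr mulr1.
    by rewrite /Num.max; repeat case: ifP => /=; lra.
  right; exists (\sum_(0 <= i < s) f i)%N, s.
  split => //; first by rewrite big_nat_recr//= fs addn1.
  rewrite subSnn mulr1 /=; congr (Num.max (_ + _ - _) _).
  case: IH => [[-> ->]//|[j [r [cs jr rs ->]]]].
  by rewrite cs /= /frame_length (frame_startE jr) -cs (frame_startE (atstart s fs)).
move=> [ft <-] {k}; case: (inv t) => [[-> ->]//|[j [r [ct jr rt ->]]]].
by rewrite ct /= /frame_length (frame_startE jr) -ct (frame_startE (atstart t ft)).
Qed.

End Paths.

(** * Pathwise drift analysis of the algorithm *)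

Section Algorithm.
Variables (R : realType) (A : Type) (idle : A) (phi p : A -> R).
Variables (lambda B beta V pmin pmax : R).
Hypotheses (phi_range : forall a, 0 <= phi a <= 1) (p_ge0 : forall a, 0 <= p a).
Hypotheses (phi_idle : phi idle = 0) (p_idle : p idle = 0).
Hypothesis lambda_gt0 : 0 < lambda.
Hypotheses (B_gt0 : 0 < B) (beta_gt0 : 0 < beta) (V_gt0 : 0 < V).
Hypotheses (pmin_gt0 : 0 < pmin) (p_le : forall a, p a <= pmax).
Hypothesis (p_ge : forall a, a <> idle -> pmin <= p a).
Variables (f : nat -> bool) (a : nat -> A).
Hypothesis a_idle : forall t, f t = false -> a t = idle.
Hypothesis alg : follows_algorithm phi p lambda B beta V f a.

Let Z := slot_queue p beta a.

Lemma mean_frame_gt0 b : 0 < 1 + phi b / lambda.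
Proof.
have /andP[p0 _] := phi_range b.
by have : 0 <= phi b / lambda; [exact: divr_ge0 p0 (ltW _)|lra].
Qed.

(** Every slot with [f t] starts the frame indexed by the number of earlier visits, so the rule
    stated with [Q[k]] can be read with [Z t]. *)
Lemma slot_queue_maximizer t b : f t ->
  frame_ratio phi p lambda B V (Z t) b <= frame_ratio phi p lambda B V (Z t) (a t).
Proof.
move=> ft; have st : is_frame_start f (\sum_(0 <= s < t) f s)%N t by [].
rewrite /Z -(slot_queue_frame (f := f) _ _ st) ?(ltW beta_gt0)//.
  exact: alg.
by move=> s /negbTE fs; rewrite a_idle.
Qed.

(** The threshold above which no power is spent, plus the largest overshoot of one slot. *)
Definition queue_bound := V * B / pmin + pmax.

Lemma slot_queue_le t : Z t <= queue_bound.
Proof.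
have VB : 0 <= V * B / pmin by rewrite divr_ge0// ?mulr_ge0// ltW.
have pmax0 : 0 <= pmax by exact: le_trans (p_ge0 idle) (p_le idle).
elim: t => [|t IH]; first by rewrite /Z /= /queue_bound addr_ge0.
rewrite /Z /= -/(Z t) ge_max [X in _ && X]addr_ge0// andbT.
have [small|big] := leP (Z t) (V * B / pmin).
  by apply: le_trans (lerD small (p_le (a t))); rewrite lerBlDr lerDl ltW.
suff pa0 : p (a t) = 0 by rewrite pa0; have := beta_gt0; lra.
case fE : (f t); last by rewrite a_idle.
(* Idling has ratio 0, so the chosen action satisfies [V * B * phi >= Z * p]; for a non-idle action
   this contradicts [Z * pmin > V * B]. *)
have := slot_queue_maximizer idle fE.
rewrite /frame_ratio phi_idle p_idle !mulr0 subr0 mul0r.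
rewrite pmulr_lge0 ?invr_gt0 ?mean_frame_gt0// => h.
apply/eqP/negP => /negP pn0.
have pge : pmin <= p (a t) by apply: p_ge => aE; rewrite aE p_idle eqxx in pn0.
have /andP[_ ph1] := phi_range (a t).
move: big; rewrite ltr_pdivrMr// => big.
have : Z t * pmin <= Z t * p (a t) by rewrite ler_wpM2l ?slot_queue_ge0.
have : V * B * phi (a t) <= V * B by rewrite ler_piMr ?mulr_ge0// ltW.
lra.
Qed.

Variable mu : R.
(** The only trace of the i.i.d. policy in the pathwise argument; [iid_le_frame_ratio] discharges
    it. *)
Hypothesis mu_le : forall q theta, 0 <= q ->
  (forall b, frame_ratio phi p lambda B V q b <= theta) ->
  V * mu - q * beta <= theta.

Let W t := V * mu - Z t * beta.
Let N t : R := (~~ f t)%:R.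
Let D t := N t.+1 - transition phi lambda (f t) (a t) false.
Let Psi t := Z t ^+ 2 / 2 + W t * N t / lambda.
(** The first term bounds the second-order part of the drift of [Z ^+ 2 / 2], the last one the
    effect of the change of [W] on the potential. *)
Definition drift_const := (beta ^+ 2 + pmax ^+ 2) / 2 + beta ^+ 2 / lambda.

(* [1 + phi / lambda] in a slot with F = 1 and [0] in a slot with F = 0 both
   equal [1] plus the conditional mean increment of [N / lambda], so the weight
   of a whole frame is spread over its slots by the potential [W N / lambda]. *)
Lemma drift_step t : V * mu - drift_const + (Psi t.+1 - Psi t) - W t * D t / lambda
  <= V * B * phi (a t).
Proof.
have l0 : lambda != 0 by rewrite gt_eqF.
have Zt0 : 0 <= Z t := slot_queue_ge0 p beta a t.
(* With [f t] this is maximality of the ratio with its denominator cleared; otherwise both sides are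
   0. *)
have W_le : W t * ((f t)%:R + (phi (a t)) / lambda) + Z t * p (a t)
    <= V * B * phi (a t).
  case fE : (f t); last by rewrite a_idle// phi_idle p_idle /=; lra.
  have Wr : W t <= frame_ratio phi p lambda B V (Z t) (a t).
    by apply: mu_le => // b; exact: slot_queue_maximizer.
  by move: Wr; rewrite /frame_ratio ler_pdivlMr ?mean_frame_gt0//=; lra.
have flow : (f t)%:R + phi (a t) / lambda =
    1 + (transition phi lambda (f t) (a t) false - N t) / lambda.
  rewrite /N; case fE : (f t) => /=; first by rewrite subr0.
  by rewrite a_idle// phi_idle; field.
have sq : Z t.+1 ^+ 2 <= (Z t + p (a t) - beta) ^+ 2.
  rewrite /Z /= -/(Z t) /Num.max; case: ifP => // _.
  by rewrite expr0n sqr_ge0.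
have pp : (p (a t) - beta) ^+ 2 <= beta ^+ 2 + pmax ^+ 2.
  have : p (a t) ^+ 2 <= pmax ^+ 2.
    by rewrite ler_sqr ?nnegrE// (le_trans (p_ge0 idle)).
  have : 0 <= p (a t) * beta by rewrite mulr_ge0// ltW.
  by rewrite !expr2; lra.
(* [Z] drops by at most [beta] in a slot, so [W] rises by at most [beta ^+ 2]. *)
have dW : (W t.+1 - W t) * N t.+1 / lambda <= beta ^+ 2 / lambda.
  rewrite ler_pM2r ?invr_gt0//.
  have h : W t.+1 - W t <= beta ^+ 2.
    have := slot_queue_step p beta a t; have := p_ge0 (a t); rewrite -/Z.
    rewrite /W => h1 h2.
    have : beta * (Z t - Z t.+1) <= beta * beta by apply: ler_wpM2l; [exact: ltW|lra].
    by rewrite expr2; lra.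
  rewrite /N; case: (f t.+1) => /=; last by rewrite mulr1.
  by rewrite mulr0 sqr_ge0.
move: W_le; rewrite flow; apply: le_trans.
rewrite /Psi /drift_const /D.
set tr := transition _ _ _ _ _.
set x := Z t.+1 ^+ 2 in sq *; set y := beta ^+ 2 / lambda in dW *.
rewrite [V * mu](_ : _ = W t + Z t * beta); last by rewrite /W; ring.
move: dW; set w' := W t.+1; set w := W t; set n' := N t.+1; set n := N t => dW.
set li := lambda^-1 in dW *.
rewrite -subr_ge0.
(* The gap between the two sides is a combination of the slacks in [sq], [pp] and [dW], with
   positive coefficients. *)
have -> : w * (1 + (tr - n) * li) + Z t * p (a t) -
  (w + Z t * beta - ((beta ^+ 2 + pmax ^+ 2) / 2 + y) +
   (x / 2 + w' * n' * li - (Z t ^+ 2 / 2 + w * n * li)) -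
   w * (n' - tr) * li) =
  ((Z t + p (a t) - beta) ^+ 2 - x) / 2 +
  (beta ^+ 2 + pmax ^+ 2 - (p (a t) - beta) ^+ 2) / 2 +
  (y - (w' - w) * n' * li) by field.
lra.
Qed.

Definition weight_bound := V * `|mu| + queue_bound * beta.

Lemma weight_le t : `|W t| <= weight_bound.
Proof.
rewrite /W (le_trans (ler_normB _ _))// normrM (gtr0_norm V_gt0) lerD2l.
by rewrite ger0_norm ?mulr_ge0 ?slot_queue_ge0 ?ler_pM2r ?slot_queue_le// ltW.
Qed.

(** Sums [drift_step]: [Psi] telescopes, and each of its two end values is bounded independently of
    [T], whence the factor 2. *)
Lemma sum_reward_ge T :
  V * (\sum_(0 <= t < T) B * phi (a t)) >=
  (V * mu - drift_const) * T%:R - 2 * (queue_bound ^+ 2 + weight_bound / lambda)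
  - \sum_(0 <= t < T) W t * D t / lambda.
Proof.
have PsiB t : `|Psi t| <= queue_bound ^+ 2 + weight_bound / lambda.
  rewrite (le_trans (ler_normD _ _))// lerD//.
    rewrite ger0_norm ?divr_ge0 ?sqr_ge0//.
    have : Z t ^+ 2 <= queue_bound ^+ 2.
      rewrite ler_sqr ?nnegrE ?slot_queue_le ?slot_queue_ge0//.
      exact: le_trans (slot_queue_ge0 p beta a t) (slot_queue_le t).
    by have := sqr_ge0 (Z t); lra.
  rewrite normrM [`|lambda^-1|]gtr0_norm ?invr_gt0// ler_pM2r ?invr_gt0//.
  rewrite normrM /N; case: (f t) => /=; last by rewrite normr1 mulr1 weight_le.
  by rewrite normr0 mulr0 (le_trans (normr_ge0 (W 0%N)))// weight_le.
have tele : (V * mu - drift_const) * T%:R + (Psi T - Psi 0%N) -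
    \sum_(0 <= t < T) W t * D t / lambda <= V * (\sum_(0 <= t < T) B * phi (a t)).
  elim: T => [|T IH]; first by rewrite !big_geq//; lra.
  rewrite !big_nat_recr//= -natr1; have := drift_step T; lra.
apply: le_trans tele; rewrite lerD2r lerD2l.
by have := PsiB T; have := PsiB 0%N; rewrite !ler_norml; lra.
Qed.

End Algorithm.

(** * Integrals of bounded functions under a probability *)

Section BoundedIntegrals.
Context {d : measure_display} {Omega : measurableType d} {R : realType}.
Variable P : probability Omega R.

Lemma bounded_integrable (D : set Omega) (f : Omega -> R) (c : R) :
    measurable D -> measurable_fun D f -> (forall w, D w -> `|f w| <= c) ->
  P.-integrable D (EFin \o f).
Proof.
move=> mD mf fc; apply: measurable_bounded_integrable => //.
  exact: le_lt_trans (probability_le1 P mD) (ltry _).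
exists c; split; first exact: num_real.
by move=> M cM w Dw; exact: le_trans (fc w Dw) (ltW cM).
Qed.

Lemma Rintegral_probability_cst (c : R) : \int[P]_w c = c.
Proof.
by rewrite Rintegral_cst// (congr1 fine (probability_setT P)) mulr1.
Qed.

Lemma bounded_Rintegral_le (f : Omega -> R) (c : R) :
    measurable_fun setT f -> (forall w, `|f w| <= c) ->
  `|\int[P]_w f w| <= c.
Proof.
move=> mf fc; have fi := bounded_integrable measurableT mf (fun w _ => fc w).
apply: le_trans (le_normr_Rintegral measurableT fi) _.
rewrite -[leRHS]Rintegral_probability_cst.
apply: le_Rintegral => //; last exact: finite_measure_integrable_cst.
exact: integrable_norm.
Qed.

End BoundedIntegrals.

(** * Averages of a bounded sequence, controlled along the squares *)

Section AverageOfBoundedSequence.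
Context {R : realType}.

(** The right side has increments [2 / (x * (x + 1))], which dominate the inverse square of [x] for
    [x >= 1]. *)
Lemma sum_inv_sqr_le (n : nat) :
  \sum_(0 <= k < n) (k.+1%:R ^+ 2)^-1 <= 2 - 2 / n.+1%:R :> R.
Proof.
elim: n => [|n IH]; first by rewrite big_geq// divr1 subrr.
rewrite big_nat_recr//=; apply: le_trans (lerD IH (lexx _)) _.
rewrite -[n.+2%:R]natr1; set x : R := n.+1%:R.
have x1 : 1 <= x by rewrite ler1n.
rewrite -subr_ge0.
have -> : 2 - 2 / (x + 1) - (2 - 2 / x + (x ^+ 2)^-1) = (x - 1) / (x ^+ 2 * (x + 1)).
  by field; apply/andP; split; lra.
by rewrite divr_ge0 ?mulr_ge0 ?sqr_ge0//; lra.
Qed.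

Lemma sqrt_floor (T : nat) : exists m, (m ^ 2 <= T < m.+1 ^ 2)%N.
Proof.
elim: T => [|T [m /andP[mT Tm]]]; first by exists 0%N.
have [h|h] := ltnP T.+1 (m.+1 ^ 2)%N; first by exists m; rewrite h andbT ltnW.
by exists m.+1; apply/andP; split => //; rewrite !expnS !expn0 in h Tm *; nia.
Qed.

(** For [T] between consecutive squares of [m] and [m + 1], the terms past the square of [m]
    contribute at most [2 * c / m] to the average. *)
Lemma average_cvg0 (x : nat -> R) (c : R) :
    (forall t, `|x t| <= c) ->
    (fun n => time_average x (n.+1 ^ 2) ^+ 2) @ \oo --> (0 : R) ->
  time_average x @ \oo --> (0 : R).
Proof.
move=> xc sq; have c0 : 0 <= c := le_trans (normr_ge0 _) (xc 0%N).
apply/cvgr0Pnorm_le => e e0.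
have e20 : 0 < (e / 2) ^+ 2 by rewrite exprn_gt0// divr_gt0.
move/cvgr0Pnorm_le : sq => /(_ _ e20) [N _ HN].
(* [N] makes the average at the squares at most [e / 2], and [M] does the same for the remaining
   terms ([ce] below). *)
have [M HM] : exists M : nat, 4 * c / e <= M%:R.
  exists (Num.truncn (4 * c / e)).+1; apply/ltW/truncnS_gt.
exists ((N + M).+2 ^ 2)%N => // T /= TN.
have [m /andP[mT Tm]] := sqrt_floor T.
have Nm : ((N + M).+1 < m)%N.
  by rewrite !expnS !expn0 in TN Tm; nia.
case: m mT Tm Nm => // n mT Tm Nm.
have {}HN : `|time_average x (n.+1 ^ 2)| <= e / 2.
  have Nn : (N <= n)%N by lia.
  have e2 : 0 <= e / 2 by lra.
  have := HN n Nn; rewrite /= ger0_norm ?sqr_ge0//.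
  by rewrite -[X in X <= _ -> _]real_normK ?num_real// ler_sqr ?nnegrE.
have m0 : 0 < n.+1%:R :> R by rewrite ltr0n.
(* Consecutive squares differ by [2 * n.+1 + 1] and [T] lies strictly below the second, so at most
   [2 * n.+1] terms remain. *)
have tail : `|\sum_(n.+1 ^ 2 <= t < T) x t| <= c * (2 * n.+1%:R).
  apply: le_trans (ler_norm_sum _ _ _) _.
  apply: le_trans (ler_sum_nat (G := fun=> c) _) _; first by move=> *; exact: xc.
  rewrite sumr_const_nat -[leLHS]mulr_natr ler_wpM2l// -natrM ler_nat.
  by rewrite !expnS !expn0 in Tm *; nia.
have m2T : n.+1%:R ^+ 2 <= T%:R :> R by rewrite -natrX ler_nat.
have T0 : 0 < T%:R :> R by apply: lt_le_trans m2T; rewrite exprn_gt0.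
have head : `|\sum_(0 <= t < n.+1 ^ 2) x t| <= e / 2 * n.+1%:R ^+ 2.
  move: HN; rewrite /time_average normrM normfV natrX.
  by rewrite [`|_ ^+ 2|]ger0_norm ?sqr_ge0// ler_pdivrMl ?exprn_gt0// mulrC.
rewrite /time_average normrM normfV (gtr0_norm T0) ler_pdivrMl// mulrC.
rewrite (@big_cat_nat _ _ _ (n.+1 ^ 2)%N)//=.
apply: le_trans (ler_normD _ _) _.
apply: le_trans (lerD head tail) _.
have ce : c * (2 * n.+1%:R) <= e / 2 * n.+1%:R ^+ 2.
  rewrite expr2 mulrA mulrA ler_pM2r//.
  have : 4 * c / e <= n.+1%:R by apply: le_trans HM _; rewrite ler_nat; lia.
  by rewrite ler_pdivrMr//; lra.
have : e * n.+1%:R ^+ 2 <= e * T%:R by rewrite ler_pM2l.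
lra.
Qed.

End AverageOfBoundedSequence.

(** * A strong law for bounded orthogonal increments *)

Section OrthogonalIncrements.
Context {d : measure_display} {Omega : measurableType d} {R : realType}.
Variables (P : probability Omega R) (X : nat -> Omega -> R) (c : R).
Hypothesis X_meas : forall t, measurable_fun setT (X t).
Hypothesis X_le : forall t w, `|X t w| <= c.
Hypothesis X_orthogonal : forall t,
  \int[P]_w ((\sum_(0 <= s < t) X s w) * X t w) = 0.

Let S t w := \sum_(0 <= s < t) X s w.

Let S_meas t : measurable_fun setT (S t).
Proof. by apply: measurable_sum => s; exact: X_meas. Qed.

Let S_le t w : `|S t w| <= c * t%:R.
Proof.
apply: le_trans (ler_norm_sum _ _ _) _.
apply: le_trans (ler_sum_nat (G := fun=> c) _) _; first by move=> *; exact: X_le.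
by rewrite sumr_const_nat subn0 mulr_natr.
Qed.

(** Orthogonality removes the cross term of the expanded square, so each step adds at most
    [c ^+ 2]. *)
Lemma sum_second_moment t : \int[P]_w (S t w ^+ 2) <= c ^+ 2 * t%:R.
Proof.
have c0 (w : Omega) : 0 <= c := le_trans (normr_ge0 _) (X_le 0 w).
elim: t => [|t IH].
  rewrite (_ : (fun w => _) = cst 0); last first.
    by apply/funext => w; rewrite /S big_geq// expr0n.
  by rewrite Rintegral_probability_cst mulr0.
rewrite (_ : (fun w => _) = fun w => S t w ^+ 2 + 2 * (S t w * X t w) + X t w ^+ 2);
  last by apply/funext => w; rewrite /S big_nat_recr//=; ring.
have iS : P.-integrable setT (EFin \o (fun w => S t w ^+ 2)).
  apply: (@bounded_integrable _ _ _ P _ _ ((c * t%:R) ^+ 2)) => //.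
    exact: measurable_funX.
  by move=> w _; rewrite normrX ler_sqr ?nnegrE// mulr_ge0 ?(c0 w).
have iSX : P.-integrable setT (EFin \o (fun w => S t w * X t w)).
  apply: (@bounded_integrable _ _ _ P _ _ ((c * t%:R) * c)) => //.
    exact: measurable_funM.
  by move=> w _; rewrite normrM ler_pM.
have iX : P.-integrable setT (EFin \o (fun w => X t w ^+ 2)).
  apply: (@bounded_integrable _ _ _ P _ _ (c ^+ 2)) => //.
    exact: measurable_funX.
  by move=> w _; rewrite normrX ler_sqr ?nnegrE// (c0 w).
have i2 : P.-integrable setT (EFin \o (fun w => 2 * (S t w * X t w))).
  exact: (integrableZl measurableT 2 iSX).
rewrite RintegralD//; last exact: (integrableD measurableT iS i2).
rewrite RintegralD// RintegralZl// X_orthogonal mulr0 addr0.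
rewrite -natr1 mulrDr mulr1 lerD//.
apply: le_trans (ler_norm _) _; apply: bounded_Rintegral_le.
  exact: measurable_funX.
by move=> w; rewrite normrX ler_sqr ?nnegrE// (c0 w).
Qed.

(** The squared averages along the squares have summable integrals, so their series is almost surely
    finite and its terms tend to 0; [average_cvg0] fills in the other times. *)
Lemma orthogonal_increments_slln :
  {ae P, forall w, time_average (X ^~ w) @ \oo --> (0 : R)}.
Proof.
pose g n w := time_average (X ^~ w) (n.+1 ^ 2) ^+ 2.
have gE n w : g n w = (n.+1%:R ^+ 2)^-1 ^+ 2 * S (n.+1 ^ 2) w ^+ 2.
  by rewrite /g /time_average exprMn natrX.
have g_ge0 n w : 0 <= g n w by exact: sqr_ge0.
have g_meas n : measurable_fun setT (EFin \o g n).
  apply/measurable_EFinP; apply: measurable_funX.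
  by apply: measurable_funM => //; exact: S_meas.
have int_g n : (\int[P]_w (g n w)%:E <= (c ^+ 2 * (n.+1%:R ^+ 2)^-1)%:E)%E.
  have iS : P.-integrable setT (EFin \o (fun w => S (n.+1 ^ 2) w ^+ 2)).
    apply: (@bounded_integrable _ _ _ P _ _ ((c * (n.+1 ^ 2)%:R) ^+ 2)) => //.
      exact: measurable_funX.
    move=> w _; rewrite normrX ler_sqr ?nnegrE//.
    exact: le_trans (normr_ge0 _) (S_le _ w).
  have gnE : g n = fun w => (n.+1%:R ^+ 2)^-1 ^+ 2 * S (n.+1 ^ 2) w ^+ 2.
    by apply/funext => w; rewrite gE.
  have ig : P.-integrable setT (EFin \o g n).
    by rewrite gnE; exact: (integrableZl measurableT _ iS).
  have -> : (\int[P]_w (g n w)%:E)%E = (\int[P]_w g n w)%:E.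
    by rewrite /Rintegral fineK//; exact: integrable_fin_num.
  rewrite lee_fin gnE.
  rewrite RintegralZl// expr2 -mulrA mulrC.
  rewrite ler_pM2r ?invr_gt0 ?exprn_gt0 ?ltr0n//.
  rewrite ler_pdivrMl ?exprn_gt0 ?ltr0n// mulrC -natrX.
  exact: sum_second_moment.
have sum_lt : (\int[P]_w (\sum_(n <oo) (g n w)%:E) < +oo)%E.
  rewrite integral_nneseries//; last by move=> *; rewrite lee_fin.
  apply: (@le_lt_trans _ _ (c ^+ 2 * 2)%:E); last exact: ltry.
  apply: lime_le.
    by apply: is_cvg_nneseries => n _ _; apply: integral_ge0 => w _; rewrite lee_fin.
  apply: nearW => n.
  apply: le_trans (lee_sum _ (fun i _ => int_g i)) _.
  rewrite sumEFin lee_fin -mulr_sumr ler_wpM2l ?sqr_ge0//.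
  apply: le_trans (sum_inv_sqr_le n) _.
  by rewrite gerBl divr_ge0.
have sum_int : P.-integrable setT (fun w => \sum_(n <oo) (g n w)%:E)%E.
  apply/integrableP; split.
    apply: (@ge0_emeasurable_sum _ _ _ setT (fun n => EFin \o g n) xpredT) => //.
    by move=> n w _ _; rewrite lee_fin.
  apply: le_lt_trans sum_lt.
  rewrite (eq_integral (fun w => \sum_(n <oo) (g n w)%:E)%E)// => w _.
  by rewrite gee0_abs// nneseries_ge0// => n _ _; rewrite lee_fin.
have := integrable_ae measurableT sum_int.
apply: filterS => w /(_ I) fin.
apply: (average_cvg0 (c := c)) => [t|]; first exact: X_le.
apply: (cvg_series_cvg_0 (u_ := g ^~ w)); apply: nnseries_is_cvg => //.
by rewrite ltey_eq fin.
Qed.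

End OrthogonalIncrements.

(** * Orthogonality to bounded functions measurable for a sub-sigma-algebra *)

Section SubSigmaAlgebra.
Context {d : measure_display} {Omega : measurableType d} {R : realType}.
Variables (P : probability Omega R) (G : set (set Omega)) (D : Omega -> R) (c : R).
Hypothesis G_sub : <<s G>> `<=` measurable.
Hypotheses (D_meas : measurable_fun setT D) (D_le : forall w, `|D w| <= c).
Hypothesis D_null : forall E, <<s G>> E -> \int[P]_(w in E) D w = 0.

Lemma measurable_fun_sub (Y : Omega -> R) :
  measurable_fun (setT : set (g_sigma_algebraType G)) Y ->
  measurable_fun (setT : set Omega) Y.
Proof. by move=> mY _ B mB; apply: G_sub; exact: mY. Qed.

(** The sum is the integer part of [y]. The induction separates the case where all [N] steps are
    reached from the case where [y] is already approximated. *)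
Lemma staircase_approx (y : R) (N : nat) : 0 <= y <= N%:R ->
  `|y - \sum_(0 <= j < N) (j.+1%:R <= y)%R%:R| <= 1.
Proof.
move=> /andP[y0 yN].
have : (N%:R <= y /\ \sum_(0 <= j < N) (j.+1%:R <= y)%R%:R = N%:R :> R) \/
    (y < N%:R /\ `|y - \sum_(0 <= j < N) (j.+1%:R <= y)%R%:R| <= 1).
  elim: N {yN} => [|N IH]; first by left; rewrite big_geq.
  rewrite big_nat_recr//= -natr1.
  case: IH => [[Ny ->]|[yN IH]]; case: leP => /= h.
  - by left.
  - by right; split => //; rewrite addr0 ler_norml; lra.
  - by exfalso; lra.
  - by right; split => //; rewrite addr0.
case=> [[Ny ->]|[]//].
have -> : y = N%:R by lra.
by rewrite subrr normr0.
Qed.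

(* D pairs to 0 with the indicators of sub-sigma-algebra events, and n (Y + K)
   is within 1 of a sum of such indicators, so n `|E[Y D]| <= c for all n. *)
Lemma Rintegral_orthogonal (Y : Omega -> R) (K : R) :
    measurable_fun (setT : set (g_sigma_algebraType G)) Y ->
    (forall w, `|Y w| <= K) ->
  \int[P]_w (Y w * D w) = 0.
Proof.
move=> mY YK.
have mY' := measurable_fun_sub mY.
have iYD : P.-integrable setT (EFin \o (fun w => Y w * D w)).
  apply: (@bounded_integrable _ _ _ P _ _ (K * c)) => //.
    exact: measurable_funM.
  by move=> w _; rewrite normrM ler_pM.
have iD : P.-integrable setT (EFin \o D).
  by apply: (@bounded_integrable _ _ _ P _ _ c).
have D0 : \int[P]_w D w = 0.
  by apply: D_null; exact: (@measurableT _ (g_sigma_algebraType G)).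
have bound n : n%:R * `|\int[P]_w (Y w * D w)| <= c.
  pose y w := n%:R * (Y w + K).
  (* Since [Y] is at most [K], this many steps cover the range of [y]. *)
  pose N := (Num.truncn (n%:R * (K + K))).+1.
  have yN w : 0 <= y w <= N%:R.
    have := YK w; rewrite ler_norml => /andP[Y1 Y2].
    rewrite mulr_ge0//=; last by lra.
    apply: le_trans (ltW (truncnS_gt _)).
    by rewrite ler_wpM2l// lerD2r.
  pose ind j w : R := (j.+1%:R <= y w)%R%:R.
  have GI j : <<s G>> [set w | j.+1%:R <= y w].
    have := @measurable_fun_ler _ (g_sigma_algebraType G) R setT (cst j.+1%:R) y.
    have my : measurable_fun (setT : set (g_sigma_algebraType G)) y.
      by apply: measurable_funM => //; apply: measurable_funD.
    move=> /(_ (measurable_cst _) my).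
    by move=> /(_ measurableT [set true] I); rewrite setTI.
  have IE j : ind j = \1_[set w | j.+1%:R <= y w].
    apply/funext => w; rewrite /ind indicE; congr (nat_of_bool _)%:R.
    by apply/idP/idP; rewrite inE.
  have mI j : measurable_fun setT (ind j).
    by rewrite IE; apply: measurable_indic; apply: G_sub; exact: GI.
  have iID j : P.-integrable setT (EFin \o (fun w => ind j w * D w)).
    apply: (@bounded_integrable _ _ _ P _ _ c) => //.
      exact: measurable_funM.
    move=> w _; rewrite /ind; case: (j.+1%:R <= _); first by rewrite mul1r.
    rewrite mulr0n mul0r normr0.
    exact: le_trans (D_le w).
  have ID0 j : \int[P]_w (ind j w * D w) = 0.
    rewrite -(D_null (GI j)) [RHS]Rintegral_mkcond; congr Rintegral.
    apply/funext => w; rewrite /ind patchE; case: ifPn => [/set_mem/= ->|/negP h].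
      by rewrite mul1r.
    by case: leP => [h'|_]; [case: h; rewrite inE|rewrite mul0r].
  have sumID M : P.-integrable setT (EFin \o (fun w => (\sum_(0 <= j < M) ind j w) * D w))
      /\ \int[P]_w ((\sum_(0 <= j < M) ind j w) * D w) = 0.
    elim: M => [|M [iM eM]].
      rewrite (_ : (fun w => _) = cst 0); last first.
        by apply/funext => w; rewrite big_geq//= mul0r.
      rewrite Rintegral_probability_cst; split => //.
      exact: finite_measure_integrable_cst.
    rewrite (_ : (fun w => _) = fun w =>
      (\sum_(0 <= j < M) ind j w) * D w + ind M w * D w); last first.
      by apply/funext => w; rewrite big_nat_recr//= mulrDl.
    split; last by rewrite RintegralD// eM ID0 addr0.
    exact: (integrableD measurableT iM (iID M)).
  have [iN eN] := sumID N.
  have iyD : P.-integrable setT (EFin \o (fun w => n%:R * (Y w * D w) + n%:R * K * D w)).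
    exact: (integrableD measurableT (integrableZl measurableT n%:R iYD)
                                    (integrableZl measurableT (n%:R * K) iD)).
  rewrite -[n%:R]normr_nat -normrM.
  (* The shift by [K] contributes a multiple of the integral of [D], and the staircase sum a sum of
     indicator pairings; both are 0. *)
  have -> : n%:R * \int[P]_w (Y w * D w) =
      \int[P]_w ((y w - \sum_(0 <= j < N) ind j w) * D w).
    rewrite (_ : (fun w => (_ - _) * _) = fun w =>
      n%:R * (Y w * D w) + n%:R * K * D w -
      (\sum_(0 <= j < N) ind j w) * D w); last first.
      by apply/funext => w; rewrite /y; ring.
    rewrite RintegralB// eN subr0 RintegralD//.
    - by rewrite !RintegralZl// D0 mulr0 addr0.
    - exact: (integrableZl measurableT n%:R iYD).
    - exact: (integrableZl measurableT (n%:R * K) iD).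
  apply: bounded_Rintegral_le.
    apply: measurable_funM => //; apply: measurable_funB.
      by apply: measurable_funM => //; exact: measurable_funD.
    exact: measurable_sum.
  move=> w; rewrite normrM -[leRHS]mul1r ler_pM//.
  exact: staircase_approx.
apply/eqP; rewrite -normr_eq0; apply/eqP/le_anti; rewrite normr_ge0 andbT.
rewrite leNgt; apply/negP => I0.
have := bound (Num.truncn (c / `|\int[P]_w (Y w * D w)|)).+1.
by rewrite -ler_pdivlMr// leNgt truncnS_gt.
Qed.

End SubSigmaAlgebra.

(** * Measurability over an arbitrary sigma-algebra, so that it applies to the past as well as to
    [Omega] *)

Section AdaptedMeasurability.
Context {d d' : measure_display} {T : measurableType d} {A : measurableType d'}.
Context {R : realType}.
Variables (phi p : A -> R) (lambda beta : R).
Hypotheses (phi_meas : measurable_fun setT phi) (p_meas : measurable_fun setT p).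
Variables (F : nat -> T -> bool) (alpha : nat -> T -> A).

Lemma slot_queue_measurable (t : nat) :
    (forall s, (s < t)%N -> measurable_fun setT (alpha s)) ->
  measurable_fun setT (fun w => slot_queue p beta (alpha ^~ w) t).
Proof.
elim: t => [|t IH] ma /=; first exact: measurable_cst.
apply: measurable_maxr; last exact: measurable_cst.
apply: measurable_funB; last exact: measurable_cst.
apply: measurable_funD; first by apply: IH => s st; apply: ma; exact: ltnW.
by apply: measurableT_comp => //; exact: ma.
Qed.

Lemma transition_measurable (t : nat) (g : bool) :
    measurable_fun setT (F t) -> measurable_fun setT (alpha t) ->
  measurable_fun setT (fun w => transition phi lambda (F t w) (alpha t w) g).
Proof.
move=> mF ma; have mphi : measurable_fun setT (phi \o alpha t) by exact: measurableT_comp.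
case: g; rewrite /transition; apply: measurable_fun_ifT => //.
exact: measurable_funB.
Qed.

Lemma absent_measurable (t : nat) :
  measurable_fun setT (F t) -> measurable_fun setT (fun w => (~~ F t w)%:R : R).
Proof.
move=> mF; rewrite (_ : (fun w => _) = fun w => if F t w then 0 else 1); last first.
  by apply/funext => w; case: (F t w).
exact: measurable_fun_ifT.
Qed.

End AdaptedMeasurability.

(** * The innovations of the state process and their weighted averages *)

Section Innovation.
Context {R : realType} {d d' : measure_display} {A : measurableType d'}.
Variables (idle : A) (phi p : A -> R) (lambda beta : R).
Hypotheses (phi_meas : measurable_fun setT phi) (p_meas : measurable_fun setT p).
Hypothesis phi_range : forall a, 0 <= phi a <= 1.
Hypotheses (lambda_gt0 : 0 < lambda) (lambda_le1 : lambda <= 1).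
Context {Omega : measurableType d}.
Variables (P : probability Omega R) (F : nat -> Omega -> bool).
Variable alpha : nat -> Omega -> A.
Hypothesis policy : decision_policy idle phi lambda P F alpha.

Definition innovation (t : nat) (w : Omega) : R :=
  (~~ F t.+1 w)%:R - transition phi lambda (F t w) (alpha t w) false.

(** The generating family of [history], named so that the past up to [t] becomes a measurable
    type. *)
Let generators t := [set E | exists2 s : nat, (s <= t)%N &
   E = F s @^-1` [set true] \/
   exists2 B : set A, measurable B & E = alpha s @^-1` B].
Let past t := g_sigma_algebraType (generators t).

Lemma history_measurable t : history F alpha t `<=` measurable.
Proof.
apply: smallest_sub; first exact: sigma_algebra_measurable.
move=> _ [s _ [->|[B mB ->]]].
  by rewrite -[X in measurable X]setTI; exact: (policy_state_measurable policy).
by rewrite -[X in measurable X]setTI; exact: (policy_action_measurable policy).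
Qed.

Lemma state_past t s : (s <= t)%N -> measurable_fun (setT : set (past t)) (F s).
Proof.
move=> st; apply: (measurable_fun_bool true); rewrite setTI.
by apply: sub_gen_smallest; exists s => //; left.
Qed.

Lemma action_past t s : (s <= t)%N -> measurable_fun (setT : set (past t)) (alpha s).
Proof.
move=> st _ B mB; rewrite setTI.
by apply: sub_gen_smallest; exists s => //; right; exists B.
Qed.

Lemma transition_range f a g : 0 <= transition phi lambda f a g <= 1.
Proof.
have /andP[p0 p1] := phi_range a.
have := lambda_gt0; have := lambda_le1.
by case: f; case: g => /=; lra.
Qed.

Lemma innovation_le t w : `|innovation t w| <= 1.
Proof.
have := transition_range (F t w) (alpha t w) false; rewrite /innovation ler_norml.
by case: (F t.+1 w) => /=; lra.
Qed.

Lemma innovation_measurable t : measurable_fun setT (innovation t).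
Proof.
apply: measurable_funB.
  by apply: absent_measurable; exact: (policy_state_measurable policy).
apply: transition_measurable => //.
  exact: (policy_state_measurable policy).
exact: (policy_action_measurable policy).
Qed.

(** This is [policy_transition] at [g = false]: both terms of the innovation have the same integral
    over [E]. *)
Lemma innovation_null t E : history F alpha t E ->
  \int[P]_(w in E) innovation t w = 0.
Proof.
move=> hE; have mE := history_measurable hE.
have mF := policy_state_measurable policy; have ma := policy_action_measurable policy.
have mtr : measurable_fun setT
    (fun w => transition phi lambda (F t w) (alpha t w) false).
  exact: transition_measurable.
have mN : measurable_fun setT (fun w => (~~ F t.+1 w)%:R : R).
  exact: absent_measurable.
rewrite RintegralB//.
- rewrite /Rintegral -(policy_transition policy false hE).
  rewrite (eq_integral (fun w => (\1_(F t.+1 @^-1` [set false]) w)%:E)); last first.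
    move=> w _; rewrite indicE; congr ((nat_of_bool _)%:R%:E).
    by apply/idP/idP; rewrite inE /=; case: (F _ _).
  rewrite integral_indic//; first by rewrite setIC subrr.
  by rewrite -[X in measurable X]setTI; exact: mF.
- apply: (@bounded_integrable _ _ _ P _ _ 1) => //; first exact: measurable_funTS.
  by move=> w _; case: (F _ _); rewrite ?normr0 ?normr1.
- apply: (@bounded_integrable _ _ _ P _ _ 1) => //; first exact: measurable_funTS.
  move=> w _; have := transition_range (F t w) (alpha t w) false.
  by rewrite ler_norml; lra.
Qed.

(** The weight at [t] and all earlier increments are bounded functions of the past up to [t], hence
    orthogonal to the innovation at [t]. *)
Lemma weighted_innovation_slln (r c : R) :
    (forall t w, `|r - slot_queue p beta (alpha ^~ w) t * beta| <= c) ->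
  {ae P, forall w, time_average (fun t =>
     (r - slot_queue p beta (alpha ^~ w) t * beta) * innovation t w / lambda)
   @ \oo --> (0 : R)}.
Proof.
move=> wc; pose W t w := r - slot_queue p beta (alpha ^~ w) t * beta.
pose X t w := W t w * innovation t w / lambda.
have Wpast t s : (s <= t)%N -> measurable_fun (setT : set (past t)) (W s).
  move=> st; apply: measurable_funB; first exact: measurable_cst.
  apply: measurable_funM; last exact: measurable_cst.
  apply: slot_queue_measurable => // j js; apply: action_past.
  by apply: leq_trans st; exact: ltnW.
(* Strict inequality here, unlike in [Wpast], because [X s] involves [F s.+1]. *)
have Xpast t s : (s < t)%N -> measurable_fun (setT : set (past t)) (X s).
  move=> st; apply: measurable_funM; last exact: measurable_cst.
  apply: measurable_funM; first by apply: Wpast; exact: ltnW.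
  apply: measurable_funB; first by apply: absent_measurable; exact: state_past.
  apply: transition_measurable => //; first by apply: state_past; exact: ltnW.
  by apply: action_past; exact: ltnW.
have Xmeas t : measurable_fun setT (X t).
  by apply: (measurable_fun_sub (@history_measurable t.+1)); exact: Xpast.
have Xle t w : `|X t w| <= c / lambda.
  rewrite /X normrM [`|lambda^-1|]gtr0_norm ?invr_gt0// ler_pM2r ?invr_gt0//.
  by rewrite normrM -[leRHS]mulr1 ler_pM ?innovation_le//; exact: wc.
apply: (orthogonal_increments_slln Xmeas Xle) => t.
rewrite (_ : (fun w => _) = fun w =>
    (\sum_(0 <= s < t) X s w) * (W t w / lambda) * innovation t w); last first.
  by apply/funext => w; rewrite /X; ring.
apply: (@Rintegral_orthogonal _ _ _ P (generators t) _ 1 _ _ _ _ _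
          (c / lambda * t%:R * (c / lambda))) => //.
- exact: history_measurable.
- exact: innovation_measurable.
- exact: innovation_le.
- by move=> E; exact: innovation_null.
- apply: measurable_funM.
    rewrite (_ : (fun w => _) = fun w => \sum_(s < t) X s w); last first.
      by apply/funext => w; rewrite big_mkord.
    by apply: measurable_sum => s; exact: Xpast.
  by apply: measurable_funM; [exact: Wpast|exact: measurable_cst].
- move=> w; rewrite normrM ler_pM//.
    apply: le_trans (ler_norm_sum _ _ _) _.
    apply: le_trans (ler_sum_nat (G := fun=> c / lambda) _) _; first by move=> *; exact: Xle.
    by rewrite sumr_const_nat subn0 mulr_natr.
  by rewrite normrM [`|lambda^-1|]gtr0_norm ?invr_gt0// ler_pM2r ?invr_gt0//; exact: wc.
Qed.

End Innovation.

(** * Bounding upper and lower limits of averages by convergent sequences *)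

Section LimitsOfAverages.
Context {R : realType}.

Lemma limsup_average_le (u v : nat -> R) (l : R) :
    (forall T, (0 < T)%N -> time_average u T <= v T) -> v @ \oo --> l ->
  (limsup_average u <= l%:E)%E.
Proof.
move=> uv vl; apply/lee_addgt0Pr => e e0.
rewrite /limsup_average /limn_esup.
have [N _ HN] : \forall T \near \oo, v T <= l + e.
  by near=> T; apply: ltW; near: T; apply: (cvgr_lt _ vl); rewrite ltrDl.
apply: ereal_inf_le.
(* The tail starts at [N.+1] to exclude [T = 0], where the comparison is not assumed. *)
exists (ereal_sup ((fun T => (time_average u T)%:E) @` [set k | (N.+1 <= k)%N])).
  by exists [set k | (N.+1 <= k)%N] => //; exists N.+1.
apply: ge_ereal_sup => _ [T /= NT <-]; rewrite lee_fin.
by apply: le_trans (uv T _) (HN T _) => //=; [exact: leq_trans NT|exact: ltnW].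
Unshelve. all: by end_near. Qed.

Lemma liminf_average_ge (u v : nat -> R) (l : R) :
    (forall T, (0 < T)%N -> v T <= time_average u T) -> v @ \oo --> l ->
  (l%:E <= liminf_average u)%E.
Proof.
move=> uv vl; rewrite /liminf_average /limn_einf leeNr.
have := @limsup_average_le (\- u) (\- v) (- l).
rewrite /limsup_average /time_average.
under [X in limn_esup X]eq_fun do rewrite sumrN mulrN EFinN.
apply; last exact: cvgN.
by move=> T T0; rewrite /= sumrN mulrN lerN2; exact: uv.
Qed.

End LimitsOfAverages.

(** * Comparison of the maximal ratio with the i.i.d. policy *)

Section FrameRatioBound.
Context {R : realType} {d' : measure_display} {A : measurableType d'}.
Variables (phi p : A -> R) (lambda B beta pmax : R).
Hypotheses (phi_meas : measurable_fun setT phi) (p_meas : measurable_fun setT p).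
Hypothesis phi_range : forall a, 0 <= phi a <= 1.
Hypotheses (p_ge0 : forall a, 0 <= p a) (p_le : forall a, p a <= pmax).
Hypothesis lambda_gt0 : 0 < lambda.

(** With its denominator cleared, the ratio bound is affine in [phi] and [p], so it can be
    integrated against the law [nu] and divided by the mean frame length. *)
Lemma iid_le_frame_ratio (mu V q theta : R) :
    attained_by_iid phi p lambda B beta mu -> 0 <= q ->
    (forall b, frame_ratio phi p lambda B V q b <= theta) ->
  V * mu - q * beta <= theta.
Proof.
move=> [nu [muE pE]] q0 ratio_le.
pose ephi := \int[nu]_a phi a; pose ep := \int[nu]_a p a.
rewrite !unlock -/(Rintegral _ _ _) -/ephi -/ep in muE pE.
have iphi : nu.-integrable setT (EFin \o phi).
  apply: (@bounded_integrable _ _ _ nu _ _ 1) => // a _.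
  by have := phi_range a; rewrite ler_norml; lra.
have ip : nu.-integrable setT (EFin \o p).
  apply: (@bounded_integrable _ _ _ nu _ _ pmax) => // a _.
  by rewrite ger0_norm.
have ephi0 : 0 <= ephi by apply: Rintegral_ge0 => a _; case/andP: (phi_range a).
have m0 : 0 < 1 + ephi / lambda.
  by have : 0 <= ephi / lambda; [exact: divr_ge0 ephi0 (ltW _)|lra].
have key : V * B * ephi <= theta + theta / lambda * ephi + q * ep.
  have i1 : nu.-integrable setT (EFin \o (fun a => V * B * phi a)).
    exact: (integrableZl measurableT _ iphi).
  have i2 : nu.-integrable setT (EFin \o (fun a => theta / lambda * phi a)).
    exact: (integrableZl measurableT _ iphi).
  have i3 : nu.-integrable setT (EFin \o (fun a => q * p a)).
    exact: (integrableZl measurableT _ ip).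
  have i0 : nu.-integrable setT (EFin \o cst theta).
    exact: finite_measure_integrable_cst.
  have i02 := integrableD measurableT i0 i2.
  have : \int[nu]_a (V * B * phi a) <=
      \int[nu]_a (theta + theta / lambda * phi a + q * p a).
    apply: le_Rintegral => //; first exact: (integrableD measurableT i02 i3).
    move=> a _; have := ratio_le a.
    rewrite /frame_ratio ler_pdivrMr ?mean_frame_gt0//.
    by rewrite mulrDr mulr1; lra.
  rewrite RintegralZl// RintegralD// RintegralD// !RintegralZl//.
  by rewrite Rintegral_probability_cst.
have {}pE : q * ep <= q * (beta * (1 + ephi / lambda)).
  by apply: ler_wpM2l => //; rewrite -ler_pdivrMr.
rewrite -muE -(ler_pM2r m0) mulrBl.
have -> : V * (B * ephi / (1 + ephi / lambda)) * (1 + ephi / lambda) = V * B * ephi.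
  by rewrite -!mulrA mulVf ?mulr1// gt_eqF.
lra.
Qed.

End FrameRatioBound.

(** * Combination of the pathwise and almost sure estimates *)

Theorem theorem4p2p1 (R : realType) (d' : measure_display)
    (A : measurableType d') (idle : A) (phi p : A -> R)
    (lambda B beta pmin pmax : R)
    (phi_measurable : measurable_fun setT phi)
    (p_measurable : measurable_fun setT p)
    (phi_range : forall a, 0 <= phi a <= 1)
    (p_ge0 : forall a, 0 <= p a)
    (phi_idle : phi idle = 0)
    (p_idle : p idle = 0)
    (lambda_gt0 : 0 < lambda)
    (lambda_le1 : lambda <= 1)
    (B_gt0 : 0 < B)
    (beta_gt0 : 0 < beta)
    (pminE : is_min [set p a | a in [set~ idle]] pmin)
    (pmaxE : is_max [set p a | a in [set~ idle]] pmax)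
    (pmin_gt0 : 0 < pmin)
    (pmax_gt0 : 0 < pmax)
    (mu_attained : attained_by_iid phi p lambda B beta
       (optimal_throughput idle phi p lambda B beta)) :
  exists C0 : R, forall V : R, 0 < V ->
    forall (d : measure_display) (Omega : measurableType d)
      (P : probability Omega R) (F : nat -> Omega -> bool)
      (alpha : nat -> Omega -> A),
      decision_policy idle phi lambda P F alpha ->
      (forall w, follows_algorithm phi p lambda B beta V
                   (fun t => F t w) (fun t => alpha t w)) ->
      (forall w, (limsup_average (fun t => p (alpha t w)) <= beta%:E)%E) /\
      {ae P, forall w,
        ((optimal_throughput idle phi p lambda B beta - C0 / V)%:E <=
           liminf_average (fun t => B * phi (alpha t w))%R)%E}.
Proof.
have pmax_ub a : p a <= pmax.
  have [->|ai] := pselect (a = idle); first by rewrite p_idle ltW.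
  by apply: (pmaxE.2); exists a.
have pmin_lb a : a <> idle -> pmin <= p a by move=> ai; apply: (pminE.2); exists a.
(* The witness is chosen before [V] and depends only on [lambda], [beta] and [pmax]. *)
exists (drift_const lambda beta pmax) => V V_gt0 d Omega P F alpha policy alg.
have a_idle w t : F t w = false -> alpha t w = idle.
  exact: (policy_idle policy).
have queue_le w t : slot_queue p beta (alpha ^~ w) t <= queue_bound B V pmin pmax.
  exact: (slot_queue_le phi_range p_ge0 phi_idle p_idle lambda_gt0 B_gt0 beta_gt0
    V_gt0 pmin_gt0 pmax_ub pmin_lb (a_idle w) (alg w)).
have inv_cvg0 (C : R) : (fun T : nat => T%:R^-1 * C) @ \oo --> (0 : R).
  rewrite -[X in _ --> X](mul0r C); apply: cvgMl.
  by rewrite -cvg_shiftS; exact: cvg_harmonic.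
split=> [w|].
  apply: (@limsup_average_le _ _
    (fun T => beta + T%:R^-1 * queue_bound B V pmin pmax)).
    move=> T T0; rewrite /time_average ler_pdivrMl ?ltr0n// mulrDr.
    rewrite mulrA divff ?pnatr_eq0 -?lt0n// mul1r addrC.
    apply: le_trans (sum_power_le p beta (alpha ^~ w) T) _.
    by rewrite [_ * T%:R]mulrC lerD2r.
  by rewrite -[X in _ --> X](addr0 beta); apply: cvgD => //; exact: cvg_cst.
set mu := optimal_throughput _ _ _ _ _ _ in mu_attained *.
have ratio_ge q theta : 0 <= q ->
    (forall b, frame_ratio phi p lambda B V q b <= theta) -> V * mu - q * beta <= theta.
  exact: (iid_le_frame_ratio phi_measurable p_measurable phi_range p_ge0 pmax_ub
    lambda_gt0 mu_attained).
have weight_bd t w : `|V * mu - slot_queue p beta (alpha ^~ w) t * beta| <=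
    weight_bound B beta V pmin pmax mu.
  exact: (weight_le phi_range p_ge0 phi_idle p_idle lambda_gt0 B_gt0 beta_gt0
    V_gt0 pmin_gt0 pmax_ub pmin_lb (a_idle w) (alg w)).
have := weighted_innovation_slln phi_measurable p_measurable phi_range lambda_gt0
  lambda_le1 policy weight_bd.
apply: filterS => w noise0.
set noise := time_average _ in noise0.
(* [K] depends on [V] but not on [T], so after [sum_reward_ge] is divided by [V * T] only the loss
   [drift_const / V] survives in the limit. *)
pose K := 2 * (queue_bound B V pmin pmax ^+ 2 +
  weight_bound B beta V pmin pmax mu / lambda).
apply: (@liminf_average_ge _ _ (fun T =>
  mu - drift_const lambda beta pmax / V - V^-1 * (T%:R^-1 * K) - V^-1 * noise T)).
  move=> T T0; have T_gt0 : 0 < T%:R :> R by rewrite ltr0n.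
  pose r := \sum_(0 <= t < T) B * phi (alpha t w).
  pose s := \sum_(0 <= t < T) (V * mu - slot_queue p beta (alpha ^~ w) t * beta) *
    innovation phi lambda F alpha t w / lambda.
  have h : (V * mu - drift_const lambda beta pmax) * T%:R - K - s <= V * r :=
    sum_reward_ge phi_range p_ge0 phi_idle p_idle lambda_gt0 B_gt0 beta_gt0
      V_gt0 pmin_gt0 pmax_ub pmin_lb (a_idle w) (alg w) ratio_ge T.
  rewrite /noise /time_average -/r -/s -(ler_pM2l V_gt0) -(ler_pM2l T_gt0).
  have VN0 : V != 0 by rewrite gt_eqF.
  have TN0 : T%:R != 0 :> R by rewrite gt_eqF.
  have -> : T%:R * (V * (T%:R^-1 * r)) = V * r by field.
  apply: le_trans h; rewrite le_eqVlt; apply/orP; left; apply/eqP.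
  by field; exact/andP.
rewrite -[X in _ --> X]subr0 -[X in _ --> X - _]subr0; apply: cvgB.
  apply: cvgB; first exact: cvg_cst.
  by rewrite -[X in _ --> X](mulr0 V^-1); apply: cvgMr; exact: inv_cvg0.
by rewrite -[X in _ --> X](mulr0 V^-1); apply: cvgMr.
Qed.
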